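(* Let $R$ be a Noetherian commutative ring with non-zero identity and $I$ an ideal of $R$. Let $M$ be a finitely generated $R$-module and $N$ an $R$-module. Then: (i) $D_I(\mathrm{Hom}_R(M,N))\cong D_I(M,N)$; (ii) if $I=aR$ is a principal ideal of $R$ (with $a\in R$), then $D_{aR}(M,N)\cong D_{aR}(M,N)_a$. (Isomorphisms are of $R$-modules.)
   Context: For $R$-modules $M,N$, the generalized ideal transform is $D_I(M,N)=\varinjlim_n \mathrm{Hom}_R(I^nM,N)$, the transition maps being restriction along $I^{j}M\subseteq I^{i}M$ for $i\le j$. The ordinary ideal transform of an $R$-module $L$ is $D_I(L)=\varinjlim_n \mathrm{Hom}_R(I^n,L)=D_I(R,L)$. For $a\in R$ and an $R$-module $L$, $L_a$ denotes the localization of $L$ with respect to the multiplicatively closed set $\{a^i : i\in\mathbb{N}\}$ (containing $a^0=1$). *)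

(* Defs.v *)
From HB Require Import structures.
From mathcomp Require Import all_boot all_order all_algebra.
From mathcomp Require Import boolp classical_sets.
From mathcomp Require Import ring.

Set Implicit Arguments.
Unset Strict Implicit.
Unset Printing Implicit Defensive.

Import GRing.Theory.
Local Open Scope ring_scope.
Local Open Scope quotient_scope.

(* Submodules of M are terms of the MathComp structure [submodClosed M];
   ideals of R are submodules of the regular module R^o.  The library's
   [idealr] is not used because it only covers proper ideals. *)

Definition module_iso (R : comNzRingType) (U V : lmodType R) : Prop :=
  exists f : {linear U -> V}, bijective f.

Section Submodules.
Variables (R : comNzRingType) (M : lmodType R).

(* The submodule generated by A: the smallest submodule containing A. *)
Definition span (A : set M) : {pred M} :=
  fun x => `[< forall P : submodClosed M,
                 (forall y, A y -> y \in P) -> x \in P >].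

Lemma spanP (A : set M) x :
  reflect (forall P : submodClosed M, (forall y, A y -> y \in P) -> x \in P)
          (x \in span A).
Proof. exact: asboolP. Qed.

Lemma mem_span (A : set M) x : A x -> x \in span A.
Proof. by move=> Ax; apply/spanP => P; apply. Qed.

Lemma span_submod_closed A : submod_closed (span A).
Proof.
split=> [|a x y /spanP xA /spanP yA]; apply/spanP => P AP; first exact: rpred0.
by rewrite rpredD ?rpredZ ?xA ?yA.
Qed.

HB.instance Definition _ A := GRing.isSubmodClosed.Build R M (span A)
  (GRing.submod_closed_semi (span_submod_closed A)).

Definition whole : {pred M} := fun=> true.

Lemma whole_submod_closed : submod_closed whole.
Proof. by []. Qed.

HB.instance Definition _ := GRing.isSubmodClosed.Build R M whole
  (GRing.submod_closed_semi whole_submod_closed).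

Definition finitely_generated (P : submodClosed M) : Prop :=
  exists s : seq M, P =i span [set` s].

(* The submodule I P, i.e. the finite sums of products a *: y. *)
Definition smul (I : submodClosed R^o) (P : submodClosed M) : {pred M} :=
  span [set x | exists (a : R) (y : M), [/\ a \in I, y \in P & x = a *: y]].

HB.instance Definition _ I P := GRing.SubmodClosed.on (smul I P).

Record submodule (P : submodClosed M) :=
  Submodule { submodule_val :> M; submodule_valP : submodule_val \in P }.

Variable P : submodClosed M.

HB.instance Definition _ := [isSub for @submodule_val P].
HB.instance Definition _ := [Choice of submodule P by <:].
HB.instance Definition _ := [SubChoice_isSubLmodule of submodule P by <:].

End Submodules.

Arguments whole {R} M.

Definition noetherian (R : comNzRingType) : Prop :=
  forall I : submodClosed R^o, finitely_generated I.

Definition fg_module (R : comNzRingType) (M : lmodType R) : Prop :=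
  finitely_generated (whole M).

Section IdealPowers.
Variables (R : comNzRingType) (I : submodClosed R^o).

(* I^n, with I^0 = R. *)
Fixpoint ideal_exp (n : nat) : submodClosed R^o :=
  if n is n'.+1 then smul I (ideal_exp n') else whole R^o.

Lemma smulS (M : lmodType R) (J K : submodClosed R^o) (P Q : submodClosed M) :
  {subset J <= K} -> {subset P <= Q} -> {subset smul J P <= smul K Q}.
Proof.
move=> JK PQ x /spanP xJP; apply: (xJP (smul K Q)) => _ [a [y [aJ yP ->]]].
by apply: mem_span; exists a, y; split; [exact: JK|exact: PQ|].
Qed.

Lemma smul_sub (M : lmodType R) (J : submodClosed R^o) (P : submodClosed M) :
  {subset smul J P <= P}.
Proof. by move=> x /spanP; apply=> _ [a [y [_ yP ->]]]; rewrite rpredZ. Qed.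

Lemma ideal_exp_decr i j : (i <= j)%N ->
  {subset ideal_exp j <= ideal_exp i}.
Proof.
move/subnKC <-; elim: (j - i)%N => [|k IHk] x; rewrite ?addn0 // addnS.
by move/smul_sub/IHk.
Qed.

Definition ideal_exp_mul (M : lmodType R) (n : nat) : submodClosed M :=
  smul (ideal_exp n) (whole M).

Lemma ideal_exp_mul_decr (M : lmodType R) i j : (i <= j)%N ->
  {subset ideal_exp_mul M j <= ideal_exp_mul M i}.
Proof. by move=> ij; apply: smulS => // x; apply: ideal_exp_decr. Qed.

End IdealPowers.

Section HomModule.
Variables (R : comNzRingType) (U V : lmodType R).
Implicit Types f g : {linear U -> V}.

Lemma linear_funP f g : f =1 g -> f = g.
Proof.
case: f g => [f [[hf1] [hf2]]] [g [[hg1] [hg2]]] /= fg.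
have {}fg : f = g by apply/funext.
rewrite {}fg in hf1 hf2 *.
by congr (GRing.Linear.Pack (GRing.Linear.Class _ _)); congr (_ _);
   apply: Prop_irrelevance.
Qed.

HB.instance Definition _ := gen_eqMixin {linear U -> V}.
HB.instance Definition _ := gen_choiceMixin {linear U -> V}.

Definition hom_zero : {linear U -> V} := \0.
Definition hom_add f g : {linear U -> V} := f \+ g.
Definition hom_opp f : {linear U -> V} := \- f.
Definition hom_scale (a : R) f : {linear U -> V} := a \*: f.

Lemma hom_addA : associative hom_add.
Proof. by move=> f g h; apply: linear_funP => x /=; rewrite addrA. Qed.
Lemma hom_addC : commutative hom_add.
Proof. by move=> f g; apply: linear_funP => x /=; rewrite addrC. Qed.
Lemma hom_add0 : left_id hom_zero hom_add.
Proof. by move=> f; apply: linear_funP => x /=; rewrite add0r. Qed.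
Lemma hom_addN : left_inverse hom_zero hom_opp hom_add.
Proof. by move=> f; apply: linear_funP => x /=; rewrite addNr. Qed.

HB.instance Definition _ := GRing.isZmodule.Build {linear U -> V}
  hom_addA hom_addC hom_add0 hom_addN.

Lemma hom_scaleA a b f : hom_scale a (hom_scale b f) = hom_scale (a * b) f.
Proof. by apply: linear_funP => x /=; rewrite scalerA. Qed.
Lemma hom_scale1 : left_id 1 hom_scale.
Proof. by move=> f; apply: linear_funP => x /=; rewrite scale1r. Qed.
Lemma hom_scaleDr : right_distributive hom_scale +%R.
Proof. by move=> a f g; apply: linear_funP => x /=; rewrite scalerDr. Qed.
Lemma hom_scaleDl f : {morph hom_scale^~ f : a b / a + b}.
Proof. by move=> a b; apply: linear_funP => x /=; rewrite scalerDl. Qed.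

HB.instance Definition _ := GRing.Zmodule_isLmodule.Build R {linear U -> V}
  hom_scaleA hom_scale1 hom_scaleDr hom_scaleDl.

End HomModule.

Record direct_system (R : comNzRingType) := DirectSystem {
  ds_obj :> nat -> lmodType R;
  ds_map : forall i j, (i <= j)%N -> {linear ds_obj i -> ds_obj j};
  ds_map_id : forall i (ii : (i <= i)%N) x, ds_map ii x = x;
  ds_map_comp : forall i j k (ij : (i <= j)%N) (jk : (j <= k)%N)
    (ik : (i <= k)%N) x, ds_map jk (ds_map ij x) = ds_map ik x
}.

Section DirectLimit.
Variables (R : comNzRingType) (X : direct_system R).

(* The direct limit is the disjoint union of the X i modulo eventual equality;
   the operations go through representatives, and dlim_addE and dlim_scaleE
   give them on classes of elements of the same X i. *)
Let T := {i : nat & X i}.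

Definition dlim_equiv (x y : T) : bool :=
  `[< exists k (xk : (tag x <= k)%N) (yk : (tag y <= k)%N),
        ds_map X xk (tagged x) = ds_map X yk (tagged y) >].

Lemma dlim_equiv_class : equiv_class_of dlim_equiv.
Proof.
split=> [x|x y|y x z].
- by apply/asboolP; exists (tag x), (leqnn _), (leqnn _).
- by apply/asboolP/asboolP => -[k [xk [yk e]]]; exists k, yk, xk.
- move=> /asboolP[k [xk [yk e]]] /asboolP[l [yl [zl e']]]; apply/asboolP.
  have [km lm] := (leq_maxl k l, leq_maxr k l).
  exists (maxn k l), (leq_trans xk km), (leq_trans zl lm).
  rewrite -(ds_map_comp xk km) e -(ds_map_comp zl lm) -e'.
  by rewrite !(ds_map_comp _ _ (leq_trans yl lm)).
Qed.

Canonical dlim_equiv_rel := EquivRelPack dlim_equiv_class.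
Canonical dlim_equiv_encModRel := defaultEncModRel dlim_equiv.

Definition dlim := {eq_quot dlim_equiv}.
HB.instance Definition _ := EqQuotient.on dlim.
HB.instance Definition _ := Choice.on dlim.

Definition dlim_in (i : nat) (x : X i) : dlim := \pi_dlim (Tagged (fun n => X n) x).

Lemma dlim_inP i j (x : X i) (y : X j) :
  dlim_in x = dlim_in y <->
  exists k (ik : (i <= k)%N) (jk : (j <= k)%N), ds_map X ik x = ds_map X jk y.
Proof. by split=> [/eqquotP/asboolP//|xy]; apply/eqquotP/asboolP. Qed.

Lemma dlim_in_map i j (ij : (i <= j)%N) (x : X i) :
  dlim_in (ds_map X ij x) = dlim_in x.
Proof.
by apply/dlim_inP; exists j, (leqnn j), ij; rewrite ds_map_id.
Qed.

Lemma dlim_in_surj (u : dlim) : exists i (x : X i), u = dlim_in x.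
Proof.
by exists (tag (repr u)), (tagged (repr u)); rewrite /dlim_in -[LHS]reprK;
   case: (repr u).
Qed.

Lemma dlim_in_surj2 (u v : dlim) :
  exists i (x y : X i), u = dlim_in x /\ v = dlim_in y.
Proof.
have [[i [x ->]] [j [y ->]]] := (dlim_in_surj u, dlim_in_surj v).
exists (maxn i j), (ds_map X (leq_maxl i j) x), (ds_map X (leq_maxr i j) y).
by rewrite !dlim_in_map.
Qed.

Definition dlim_zero : dlim := dlim_in (0 : X 0%N).

Definition dlim_opp (u : dlim) : dlim := dlim_in (- tagged (repr u)).

Definition dlim_scale (a : R) (u : dlim) : dlim :=
  dlim_in (a *: tagged (repr u)).

Definition dlim_add (u v : dlim) : dlim :=
  dlim_in (ds_map X (leq_maxl (tag (repr u)) (tag (repr v))) (tagged (repr u))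
    + ds_map X (leq_maxr (tag (repr u)) (tag (repr v))) (tagged (repr v))).

Lemma dlim_repr i (x : X i) : exists k (rk : (tag (repr (dlim_in x)) <= k)%N)
  (ik : (i <= k)%N), ds_map X rk (tagged (repr (dlim_in x))) = ds_map X ik x.
Proof.
apply/dlim_inP; rewrite /dlim_in -[RHS]reprK /=.
by case: (repr (\pi_dlim (Tagged (fun n => X n) x))).
Qed.

Lemma dlim_zeroE i : dlim_zero = dlim_in (0 : X i).
Proof. by apply/dlim_inP; exists i, (leq0n i), (leqnn i); rewrite !linear0. Qed.

Lemma dlim_oppE i (x : X i) : dlim_opp (dlim_in x) = dlim_in (- x).
Proof.
have [k [rk [ik e]]] := dlim_repr x; apply/dlim_inP.
by exists k, rk, ik; rewrite !linearN e.
Qed.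

Lemma dlim_scaleE a i (x : X i) : dlim_scale a (dlim_in x) = dlim_in (a *: x).
Proof.
have [k [rk [ik e]]] := dlim_repr x; apply/dlim_inP.
by exists k, rk, ik; rewrite !linearZ /= e.
Qed.

Lemma dlim_addE i (x y : X i) :
  dlim_add (dlim_in x) (dlim_in y) = dlim_in (x + y).
Proof.
have [k [rk [ik e]]] := dlim_repr x; have [l [rl [il e']]] := dlim_repr y.
have [km lm] := (leq_maxl k l, leq_maxr k l).
apply/dlim_inP; exists (maxn k l).
have h : (maxn (tag (repr (dlim_in x))) (tag (repr (dlim_in y))) <= maxn k l)%N.
  by rewrite geq_max (leq_trans rk km) (leq_trans rl lm).
exists h, (leq_trans ik km); rewrite !linearD; congr (_ + _).
  rewrite (ds_map_comp _ _ (leq_trans rk km)).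
  by rewrite -(ds_map_comp rk km) e (ds_map_comp _ _ (leq_trans ik km)).
rewrite (ds_map_comp _ _ (leq_trans rl lm)).
by rewrite -(ds_map_comp rl lm) e' (ds_map_comp _ _ (leq_trans ik km)).
Qed.

Lemma dlim_addC : commutative dlim_add.
Proof.
by move=> u v; have [i [x [y [-> ->]]]] := dlim_in_surj2 u v;
   rewrite !dlim_addE addrC.
Qed.

Lemma dlim_addA : associative dlim_add.
Proof.
move=> u v w; have [i [x [y [-> ->]]]] := dlim_in_surj2 u v.
have [j [z ->]] := dlim_in_surj w.
have [ik jk] := (leq_maxl i j, leq_maxr i j).
rewrite -(dlim_in_map ik x) -(dlim_in_map ik y) -(dlim_in_map jk z).
by rewrite !dlim_addE addrA.
Qed.

Lemma dlim_add0 : left_id dlim_zero dlim_add.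
Proof.
move=> u; have [i [x ->]] := dlim_in_surj u.
by rewrite (dlim_zeroE i) dlim_addE add0r.
Qed.

Lemma dlim_addN : left_inverse dlim_zero dlim_opp dlim_add.
Proof.
move=> u; have [i [x ->]] := dlim_in_surj u.
by rewrite (dlim_zeroE i) dlim_oppE dlim_addE addNr.
Qed.

HB.instance Definition _ := GRing.isZmodule.Build dlim
  dlim_addA dlim_addC dlim_add0 dlim_addN.

Lemma dlim_scaleA a b u : dlim_scale a (dlim_scale b u) = dlim_scale (a * b) u.
Proof.
by have [i [x ->]] := dlim_in_surj u; rewrite !dlim_scaleE scalerA.
Qed.

Lemma dlim_scale1 : left_id 1 dlim_scale.
Proof.
by move=> u; have [i [x ->]] := dlim_in_surj u; rewrite dlim_scaleE scale1r.
Qed.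

Lemma dlim_scaleDr : right_distributive dlim_scale +%R.
Proof.
move=> a u v; have [i [x [y [-> ->]]]] := dlim_in_surj2 u v.
have addE z t : dlim_in z + dlim_in t = dlim_in (z + t) := @dlim_addE i z t.
by rewrite addE !dlim_scaleE addE scalerDr.
Qed.

Lemma dlim_scaleDl u : {morph dlim_scale^~ u : a b / a + b}.
Proof.
move=> a b; have [i [x ->]] := dlim_in_surj u.
have addE z t : dlim_in z + dlim_in t = dlim_in (z + t) := @dlim_addE i z t.
by rewrite !dlim_scaleE addE scalerDl.
Qed.

HB.instance Definition _ := GRing.Zmodule_isLmodule.Build R dlim
  dlim_scaleA dlim_scale1 dlim_scaleDr dlim_scaleDl.

Lemma dlim_in_is_linear i : linear (@dlim_in i).
Proof. by move=> a x y; rewrite -dlim_addE -dlim_scaleE. Qed.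

HB.instance Definition _ i := GRing.isLinear.Build R (X i) dlim *:%R
  (@dlim_in i) (@dlim_in_is_linear i).

End DirectLimit.

Section HomSystem.
Variables (R : comNzRingType) (M N : lmodType R).

Section Inclusion.
Variables (P Q : submodClosed M) (PQ : {subset P <= Q}).

Definition incl (x : submodule P) : submodule Q :=
  Submodule (PQ (submodule_valP x)).

Lemma incl_is_linear : linear incl.
Proof. by move=> a x y; apply: val_inj. Qed.

HB.instance Definition _ := GRing.isLinear.Build R (submodule P) (submodule Q)
  *:%R incl incl_is_linear.

Definition restrict (f : {linear submodule Q -> N}) :
  {linear submodule P -> N} := f \o incl.

Lemma restrict_is_linear : linear restrict.
Proof. by move=> a f g; apply: linear_funP. Qed.

HB.instance Definition _ := GRing.isLinear.Build R
  {linear submodule Q -> N} {linear submodule P -> N} *:%R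
  restrict restrict_is_linear.

End Inclusion.

Variables (P : nat -> submodClosed M).
Hypothesis P_decr : forall i j, (i <= j)%N -> {subset P j <= P i}.

Let hom_obj (n : nat) : lmodType R := {linear submodule (P n) -> N}.
Let hom_map i j (ij : (i <= j)%N) : {linear hom_obj i -> hom_obj j} :=
  restrict (P_decr ij).

Lemma hom_map_id i (ii : (i <= i)%N) f : hom_map ii f = f.
Proof. by apply: linear_funP => x /=; congr (f _); apply: val_inj. Qed.

Lemma hom_map_comp i j k (ij : (i <= j)%N) (jk : (j <= k)%N) (ik : (i <= k)%N)
  f : hom_map jk (hom_map ij f) = hom_map ik f.
Proof. by apply: linear_funP => x /=; congr (f _); apply: val_inj. Qed.

Definition hom_system : direct_system R := DirectSystem hom_map_id hom_map_comp.

End HomSystem.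

Section IdealTransform.
Variables (R : comNzRingType) (I : submodClosed R^o).

(* D_I(M, N) is the limit of the Hom(I^n M, N), D_I(L) of the Hom(I^n, L). *)
Definition gen_ideal_transform (M N : lmodType R) : lmodType R :=
  dlim (hom_system N (@ideal_exp_mul_decr R I M)).

Definition ideal_transform (L : lmodType R) : lmodType R :=
  dlim (hom_system L (@ideal_exp_decr R I)).

End IdealTransform.

Section Localization.
Variables (R : comNzRingType) (S : mulrClosed R) (L : lmodType R).

Record denom := Denom { den : R; denP : den \in S }.
HB.instance Definition _ := [isSub for den].
HB.instance Definition _ := [Choice of denom by <:].

Definition denom1 : denom := Denom (rpred1 S).
Definition denomM (s t : denom) : denom :=
  Denom (rpredM (denP s) (denP t)).

(* S^-1 L, as an R-module: (x, s) stands for the fraction x / s. *)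
Let T := (L * denom)%type.

Definition loc_equiv (x y : T) : bool :=
  `[< exists u : denom, den u *: (den y.2 *: x.1 - den x.2 *: y.1) = 0 >].

Lemma loc_equivP (x y : T) :
  reflect (exists u : denom, (den u * den y.2) *: x.1 = (den u * den x.2) *: y.1)
          (loc_equiv x y).
Proof.
apply/(iffP (asboolP _)) => -[u e]; exists u.
  by apply/eqP; rewrite -subr_eq0 -!scalerA -scalerBr e.
by rewrite scalerBr !scalerA e subrr.
Qed.

Lemma loc_equiv_class : equiv_class_of loc_equiv.
Proof.
split=> [x|x y|y x z].
- by apply/loc_equivP; exists denom1.
- by apply/loc_equivP/loc_equivP => -[u e]; exists u.
- move=> /loc_equivP[u e] /loc_equivP[v e']; apply/loc_equivP.
  exists (denomM (denomM u v) y.2) => /=.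
  have -> : den u * den v * den y.2 * den z.2 =
            (den v * den z.2) * (den u * den y.2) by ring.
  rewrite -scalerA e scalerA.
  have -> : den v * den z.2 * (den u * den x.2) =
            (den u * den x.2) * (den v * den z.2) by ring.
  by rewrite -scalerA e' scalerA; congr (_ *: _); ring.
Qed.

Canonical loc_equiv_rel := EquivRelPack loc_equiv_class.
Canonical loc_equiv_encModRel := defaultEncModRel loc_equiv.

Definition localization := {eq_quot loc_equiv}.
HB.instance Definition _ := EqQuotient.on localization.
HB.instance Definition _ := Choice.on localization.

Definition frac (x : L) (s : denom) : localization := \pi_localization (x, s).

Lemma fracP (x y : L) (s t : denom) :
  frac x s = frac y t <->
  exists u : denom, (den u * den t) *: x = (den u * den s) *: y.
Proof. by split=> [/eqquotP/loc_equivP|xy]; last apply/eqquotP/loc_equivP. Qed.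

Lemma frac_mul (x : L) (s t : denom) :
  frac (den t *: x) (denomM s t) = frac x s.
Proof. by apply/fracP; exists denom1; rewrite /= scalerA mulrA. Qed.

Lemma frac_surj (u : localization) : exists x s, u = frac x s.
Proof.
by exists (repr u).1, (repr u).2; rewrite /frac -[LHS]reprK; case: (repr u).
Qed.

Lemma frac_surj2 (u v : localization) :
  exists x y s, u = frac x s /\ v = frac y s.
Proof.
have [[x [s ->]] [y [t ->]]] := (frac_surj u, frac_surj v).
exists (den t *: x), (den s *: y), (denomM s t); rewrite frac_mul; split=> //.
by rewrite -(frac_mul y t s); congr frac; apply: val_inj; rewrite /= mulrC.
Qed.

Definition loc_zero : localization := frac 0 denom1.

Definition loc_opp (u : localization) : localization :=
  frac (- (repr u).1) (repr u).2.

Definition loc_scale (a : R) (u : localization) : localization :=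
  frac (a *: (repr u).1) (repr u).2.

Definition loc_add (u v : localization) : localization :=
  frac (den (repr v).2 *: (repr u).1 + den (repr u).2 *: (repr v).1)
       (denomM (repr u).2 (repr v).2).

Lemma frac_repr (x : L) (s : denom) : exists u : denom,
  (den u * den s) *: (repr (frac x s)).1 = (den u * den (repr (frac x s)).2) *: x.
Proof.
by apply/fracP; rewrite /frac -[RHS]reprK; case: (repr (\pi_localization (x, s))).
Qed.

Lemma loc_zeroE s : loc_zero = frac 0 s.
Proof. by apply/fracP; exists denom1; rewrite !scaler0. Qed.

Lemma loc_oppE x s : loc_opp (frac x s) = frac (- x) s.
Proof.
have [u e] := frac_repr x s; apply/fracP; exists u.
by rewrite !scalerN e.
Qed.

Lemma loc_scaleE a x s : loc_scale a (frac x s) = frac (a *: x) s.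
Proof.
have [u e] := frac_repr x s; apply/fracP; exists u.
by rewrite scalerA [_ * a]mulrC -(scalerA a) e !scalerA [a * _]mulrC.
Qed.

Lemma loc_addE_gen x y s t : loc_add (frac x s) (frac y t) =
  frac (den t *: x + den s *: y) (denomM s t).
Proof.
have [[u e] [v e']] := (frac_repr x s, frac_repr y t).
apply/fracP; exists (denomM u v); rewrite /= !scalerDr !scalerA.
set x' := repr _ in e *; set y' := repr _ in e' *.
congr (_ + _).
  have -> : den u * den v * (den s * den t) * den y'.2 = (den v * den t * den y'.2) * (den u * den s) by ring.
  by rewrite -scalerA e scalerA; congr (_ *: _); ring.
have -> : den u * den v * (den s * den t) * den x'.2 = (den u * den s * den x'.2) * (den v * den t) by ring.
by rewrite -scalerA e' scalerA; congr (_ *: _); ring.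
Qed.

Lemma loc_addE x y s : loc_add (frac x s) (frac y s) = frac (x + y) s.
Proof. by rewrite loc_addE_gen -scalerDr frac_mul. Qed.

Lemma loc_addC : commutative loc_add.
Proof.
by move=> u v; have [x [y [s [-> ->]]]] := frac_surj2 u v;
   rewrite !loc_addE addrC.
Qed.

Lemma loc_addA : associative loc_add.
Proof.
move=> u v w; have [x [y [s [-> ->]]]] := frac_surj2 u v.
have [z [t ->]] := frac_surj w.
rewrite -(frac_mul x s t) -(frac_mul y s t) -(frac_mul z t s).
have -> : denomM t s = denomM s t by apply: val_inj; rewrite /= mulrC.
by rewrite !loc_addE addrA.
Qed.

Lemma loc_add0 : left_id loc_zero loc_add.
Proof.
move=> u; have [x [s ->]] := frac_surj u.
by rewrite (loc_zeroE s) loc_addE add0r.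
Qed.

Lemma loc_addN : left_inverse loc_zero loc_opp loc_add.
Proof.
move=> u; have [x [s ->]] := frac_surj u.
by rewrite (loc_zeroE s) loc_oppE loc_addE addNr.
Qed.

HB.instance Definition _ := GRing.isZmodule.Build localization
  loc_addA loc_addC loc_add0 loc_addN.

Lemma fracD x y s t : frac x s + frac y t =
  frac (den t *: x + den s *: y) (denomM s t).
Proof. exact: loc_addE_gen. Qed.

Lemma fracDl x y s : frac x s + frac y s = frac (x + y) s.
Proof. exact: loc_addE. Qed.

Lemma loc_scaleA a b u : loc_scale a (loc_scale b u) = loc_scale (a * b) u.
Proof. by have [x [s ->]] := frac_surj u; rewrite !loc_scaleE scalerA. Qed.

Lemma loc_scale1 : left_id 1 loc_scale.
Proof.
by move=> u; have [x [s ->]] := frac_surj u; rewrite loc_scaleE scale1r.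
Qed.

Lemma loc_scaleDr : right_distributive loc_scale +%R.
Proof.
move=> a u v; have [x [y [s [-> ->]]]] := frac_surj2 u v.
by rewrite fracDl !loc_scaleE fracDl scalerDr.
Qed.

Lemma loc_scaleDl u : {morph loc_scale^~ u : a b / a + b}.
Proof.
move=> a b; have [x [s ->]] := frac_surj u.
by rewrite !loc_scaleE fracDl scalerDl.
Qed.

HB.instance Definition _ := GRing.Zmodule_isLmodule.Build R localization
  loc_scaleA loc_scale1 loc_scaleDr loc_scaleDl.

Lemma fracZ a x s : a *: frac x s = frac (a *: x) s.
Proof. exact: loc_scaleE. Qed.

End Localization.

Section Powers.
Variables (R : comNzRingType) (a : R).

Definition powers : {pred R} := fun x => `[< exists i : nat, x = a ^+ i >].

Lemma powers_mulr_closed : mulr_closed powers.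
Proof.
split=> [|x y /asboolP[i ->] /asboolP[j ->]]; apply/asboolP.
  by exists 0%N; rewrite expr0.
by exists (i + j)%N; rewrite exprD.
Qed.

HB.instance Definition _ := GRing.isMulClosed.Build R powers powers_mulr_closed.

Definition localize_at (L : lmodType R) : lmodType R := localization powers L.

End Powers.

(* Main.v *)
(** For (i), a map f : I^n -> Hom(M,N) comes from a map on I^l M as soon as
    every relation sum_j x_j m_j = 0 between the generators m_j of M with
    coefficients x_j in I^l gives sum_j f(x_j)(m_j) = 0.  This holds when the
    relation lies in I^n K, where K is the relation module in R^p, so it is
    enough that K meets I^l R^p inside I^n K for large l.  This weak form of
    Artin-Rees follows, by induction on the generators a_i of I and working
    modulo a submodule G, from the stabilisation of the chains
    (K + G : a_i^c); the ideal (a_1^k, ..., a_r^k) can replace I^k there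
    because it contains some power of I.
    For (ii), multiplication by a is bijective on D_aR(M,N): a map f on a^k M
    is a times the map a y |-> f(y), well defined once the kernels of the
    powers of a on M have stabilised. *)

Require Import Defs.
From HB Require Import structures.
From mathcomp Require Import all_boot all_order all_algebra.
From mathcomp Require Import boolp classical_sets.

Set Implicit Arguments.
Unset Strict Implicit.
Unset Printing Implicit Defensive.

Import GRing.Theory.
Local Open Scope ring_scope.

(* Makes [span] denote the submodule span again, rather than [vector.span]. *)
Import Defs.

(** * Submodules cut out by a closed predicate *)

Section Comprehension.
Variables (R : comNzRingType) (V : lmodType R).

Definition lin_closed (A : set V) : Prop :=
  A 0 /\ forall c x y, A x -> A y -> A (c *: x + y).

(** The closure proof is an argument so that the submodule structure can be inferred from the term
    itself. *)
Definition submod_of (A : set V) (hA : lin_closed A) : {pred V} :=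
  fun x => `[< A x >].

Lemma submod_ofP (A : set V) (hA : lin_closed A) x :
  reflect (A x) (x \in submod_of hA).
Proof. exact: asboolP. Qed.

Lemma submod_of_closed (A : set V) (hA : lin_closed A) :
  submod_closed (submod_of hA).
Proof.
case: (hA) => A0 AD; split=> [|c x y /submod_ofP Ax /submod_ofP Ay].
  exact/submod_ofP.
by apply/submod_ofP/AD.
Qed.

HB.instance Definition _ A hA := GRing.isSubmodClosed.Build R V
  (@submod_of A hA) (GRing.submod_closed_semi (submod_of_closed hA)).

Lemma span_min (A : set V) (B : set V) : lin_closed B ->
  (forall x, A x -> B x) -> forall x, x \in span A -> B x.
Proof.
move=> hB AB x /spanP/(_ (submod_of hB)) h; apply/(submod_ofP hB)/h => y Ay.
by apply/submod_ofP/AB.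
Qed.

End Comprehension.

Lemma submodN (R : comNzRingType) (V : lmodType R) (P : submodClosed V) x :
  x \in P -> - x \in P.
Proof. by rewrite -scaleN1r; apply: rpredZ. Qed.

Lemma submodB (R : comNzRingType) (V : lmodType R) (P : submodClosed V) x y :
  x \in P -> y \in P -> x - y \in P.
Proof. by move=> xP /submodN; apply: rpredD. Qed.

Lemma linear_bundle (R : comNzRingType) (U V : lmodType R) (f : U -> V) :
  linear f -> exists F : {linear U -> V}, F =1 f.
Proof.
move=> lf; pose F : {linear U -> V} :=
  HB.pack f (GRing.isLinear.Build _ _ _ _ f lf).
by exists F.
Qed.

(** * Linear maps and isomorphisms defined by linear relations *)

Section LinearRelation.
Variables (R : comNzRingType) (U V : lmodType R) (rel : U -> V -> Prop).
Hypothesis relD : forall c u u' v v',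
  rel u v -> rel u' v' -> rel (c *: u + u') (c *: v + v').

Lemma relB u u' v v' : rel u v -> rel u' v' -> rel (u - u') (v - v').
Proof.
by move=> h h'; move: (relD (-1) h' h); rewrite !scaleN1r ![- _ + _]addrC.
Qed.

(** Differences of related pairs are related, so triviality over 0 makes the relation single-valued,
    and a choice function is then automatically linear. Maps on limits and fractions can thus be
    described on representatives. *)
Lemma linear_of_relation :
  (forall u, exists v, rel u v) -> (forall v, rel 0 v -> v = 0) ->
  exists f : {linear U -> V}, forall u v, rel u v -> f u = v.
Proof.
move=> /choice[f fP] inj.
have fE u v : rel u v -> f u = v.
  move=> uv; apply/eqP; rewrite -subr_eq0; apply/eqP/inj.
  by rewrite -(subrr u); apply: relB.
have [|F FE] := @linear_bundle _ _ _ f; first by move=> c x y; apply/fE/relD.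
by exists F => u v /fE <-; rewrite FE.
Qed.

Lemma module_iso_of_relation :
  (forall u, exists v, rel u v) -> (forall v, exists u, rel u v) ->
  (forall v, rel 0 v -> v = 0) -> (forall u, rel u 0 -> u = 0) ->
  module_iso U V.
Proof.
move=> totl /choice[g gP] injl injr.
have [f fE] := linear_of_relation totl injl.
exists f; exists g => [u|v]; last exact: fE.
have [v uv] := totl u; rewrite (fE _ _ uv).
apply/eqP; rewrite -subr_eq0; apply/eqP/injr.
by rewrite -(subrr v); apply: relB.
Qed.

End LinearRelation.

(** * The ascending chain condition for finitely generated modules *)

Section AscendingChains.
Variable R : comNzRingType.

Definition acc (V : lmodType R) : Prop :=
  forall C : nat -> submodClosed V,
    (forall i j, (i <= j)%N -> {subset C i <= C j}) ->
    exists c, forall d, {subset C d <= C c}.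

(** The union of the chain is an ideal, and its finitely many generators already lie in one term. *)
Lemma acc_noetherian : noetherian R -> acc R^o.
Proof.
move=> hR C C_incr.
have hA : lin_closed [set x | exists i, x \in C i].
  split=> [|c x y [i xi] [j yj]]; first by exists 0%N; apply: rpred0.
  exists (maxn i j); apply: rpredD; first apply: rpredZ.
    exact: C_incr (leq_maxl i j) _ xi.
  exact: C_incr (leq_maxr i j) _ yj.
have [s sP] := hR (submod_of hA).
have [c cP] : exists c, {subset s <= C c}.
  have : {subset s <= submod_of hA} by move=> x xs; rewrite sP; apply: mem_span.
  elim: {sP} s => [|x s IHs] sub; first by exists 0%N.
  have [|c cP] := IHs; first by move=> y ys; apply: sub; rewrite inE ys orbT.
  have /submod_ofP[i xi] := sub x (mem_head _ _).
  exists (maxn c i) => y; rewrite inE => /predU1P[->|/cP yc].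
    exact: C_incr (leq_maxr c i) _ xi.
  exact: C_incr (leq_maxl c i) _ yc.
exists c => d x xd; have : x \in submod_of hA by apply/submod_ofP; exists d.
by rewrite sP => /spanP; apply=> y /cP.
Qed.

(** Nested submodules of [V] with the same preimage in [U] and the same image in [W] coincide, and
    the chains of preimages and of images both stabilise. *)
Lemma acc_exact (U V W : lmodType R) (f : U -> V) (g : V -> W) :
  linear f -> linear g -> (forall v, g v = 0 -> exists u, v = f u) ->
  acc U -> acc W -> acc V.
Proof.
move=> lf lg ex aU aW C C_incr.
have [[F fF] [G gG]] := (linear_bundle lf, linear_bundle lg).
have hf i : lin_closed [set u | F u \in C i].
  split=> [|c x y xi yi] /=; first by rewrite linear0 rpred0.
  by rewrite linearP rpredD // rpredZ.
have hg i : lin_closed [set w | exists2 v, v \in C i & G v = w].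
  split=> [|c x y [v vi <-] [w wi <-]].
    by exists 0; rewrite ?linear0 // rpred0.
  by exists (c *: v + w); rewrite ?linearP // rpredD // rpredZ.
have [i j ij x /submod_ofP xi|c cP] := aU (fun i => submod_of (hf i)).
  by apply/submod_ofP; apply: C_incr ij _ xi.
have [i j ij x /submod_ofP[v vi <-]|d dP] := aW (fun i => submod_of (hg i)).
  by apply/submod_ofP; exists v => //; apply: C_incr ij _ vi.
exists (maxn c d) => e x xe.
have /dP/submod_ofP[v vd vx] : G x \in submod_of (hg e).
  by apply/submod_ofP; exists x.
have [|u uP] := ex (x - v); first by rewrite -gG linearB vx subrr.
have /cP/submod_ofP uc : u \in submod_of (hf (maxn e d)).
  apply/submod_ofP => /=; rewrite fF -uP submodB //.
    exact: C_incr (leq_maxl e d) _ xe.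
  exact: C_incr (leq_maxr e d) _ vd.
rewrite -(subrK v x) uP -fF rpredD //.
  exact: C_incr (leq_maxl c d) _ uc.
exact: C_incr (leq_maxr c d) _ vd.
Qed.

(** Induction along R -> R^(1+p) -> R^p: inclusion of the first coordinate, then dropping it. *)
Lemma acc_row p : acc R^o -> acc 'rV[R]_p.
Proof.
move=> aR; elim: p => [|p IHp].
  move=> C _; exists 0%N => d x _.
  by rewrite (_ : x = 0) ?rpred0 //; apply/rowP => -[].
apply: (@acc_exact R^o 'rV[R]_(1 + p) _ (fun c => c *: delta_mx 0 0)
          rsubmx _ _ _ aR IHp).
- by move=> c x y; rewrite scalerDl scalerA.
- exact: linearP.
move=> v v0; exists (v 0 0); apply/rowP => j; rewrite !mxE eqxx /=.
have [->|] := eqVneq j 0; first by rewrite mulr1.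
case: (@split_ordP 1 p j) => i ->.
  by rewrite (ord1 i) => /eqP[]; apply: val_inj.
by move=> _; rewrite mulr0; have /rowP/(_ i) := v0; rewrite !mxE.
Qed.

Lemma fg_generators (M : lmodType R) : fg_module M ->
  exists p (m : 'I_p -> M), forall y, exists x : 'rV[R]_p,
    y = \sum_j x 0 j *: m j.
Proof.
move=> [s sP]; exists (size s), (fun j => s`_j) => y.
have : y \in span [set` s] by rewrite -sP.
apply: (span_min (B := [set y | exists x : 'rV[R]_(size s),
  y = \sum_j x 0 j *: s`_j])); last first.
  move=> {}y /= ys; pose j := Ordinal (etrans (index_mem y s) ys).
  exists (delta_mx 0 j); rewrite (bigD1 j) //= big1 => [|i ij].
    by rewrite mxE !eqxx scale1r addr0 nth_index.
  by rewrite mxE (negPf ij) andbF scale0r.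
split=> [|c _ _ [x ->] [x' ->]] /=.
  by exists 0; rewrite big1 // => j _; rewrite mxE scale0r.
exists (c *: x + x'); rewrite scaler_sumr -big_split /=.
by apply: eq_bigr => j _; rewrite !mxE scalerDl scalerA.
Qed.

Lemma acc_fg (M : lmodType R) : noetherian R -> fg_module M -> acc M.
Proof.
move=> hR /fg_generators[p [m mP]].
have aF := acc_row (p := p) (acc_noetherian hR).
(* With the zero map as second map, exactness says that R^p maps onto [M]. *)
apply: (@acc_exact 'rV[R]_p _ _ (fun x => \sum_j x 0 j *: m j)
          (fun=> 0 : 'rV[R]_p)) => // [c x y|c x y].
  rewrite scaler_sumr -big_split /=.
  by apply: eq_bigr => j _; rewrite !mxE scalerDl scalerA.
by rewrite scaler0 addr0.
Qed.

(** The kernels of the maps [a ^+ i] form an ascending chain; [c] is where it becomes constant. *)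
Lemma acc_ker_stable (M : lmodType R) (a : R) : acc M ->
  exists c, forall k (z : M), (c <= k)%N -> a ^+ k.+1 *: z = 0 -> a ^+ k *: z = 0.
Proof.
move=> aM.
have hC i : lin_closed [set z : M | a ^+ i *: z = 0].
  split=> [|c x y /= xi yi]; first by rewrite /= scaler0.
  by rewrite scalerDr scalerA mulrC -scalerA xi yi scaler0 addr0.
have [i j ij z /submod_ofP /= zi|c cP] := aM (fun i => submod_of (hC i)).
  by apply/submod_ofP; rewrite /= -(subnK ij) exprD -scalerA zi scaler0.
exists c => k z ck zk; have /cP/submod_ofP /= zc : z \in submod_of (hC k.+1).
  exact/submod_ofP.
by rewrite -(subnK ck) exprD -scalerA zc scaler0.
Qed.

End AscendingChains.

(** * A weak Artin-Rees lemma *)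

Section ArtinRees.
Variables (R : comNzRingType) (F : lmodType R) (aF : acc F).

(** Let the chain (K + G : a^i) be constant from c on and take k = n + c. If x = a^(n+c) y modulo G,
    then y lies in (K + G : a^(n+c)) = (K + G : a^c), so a^c y = l modulo G with l in K, and x = a^n
    l modulo G. *)
Lemma artin_rees_principal (a : R) (K G : submodClosed F) n :
  exists k, forall x y, x \in K -> x - a ^+ k *: y \in G ->
    exists2 l, l \in K & x - a ^+ n *: l \in G.
Proof.
have hC i : lin_closed [set y | exists2 l, l \in K & a ^+ i *: y - l \in G].
  split=> [|c x y [l lK xl] [l' l'K yl]] /=.
    by exists 0; rewrite ?scaler0 ?subr0 rpred0.
  exists (c *: l + l'); first by rewrite rpredD ?rpredZ.
  rewrite scalerDr scalerA mulrC -scalerA opprD addrACA -scalerBr.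
  by rewrite rpredD ?rpredZ.
have [i j ij z /submod_ofP[l lK zl]|c cP] := @aF (fun i => submod_of (hC i)).
  apply/submod_ofP; exists (a ^+ (j - i) *: l); first by rewrite rpredZ.
  by rewrite -{1}(subnK ij) exprD -scalerA -scalerBr rpredZ.
exists (n + c)%N => x y xK xyG.
have /cP/submod_ofP[l lK yl] : y \in submod_of (hC (n + c)%N).
  by apply/submod_ofP; exists x => //; rewrite -opprB submodN.
exists l => //.
have -> : x - a ^+ n *: l
    = (x - a ^+ (n + c) *: y) + a ^+ n *: (a ^+ c *: y - l).
  by rewrite scalerBr scalerA -exprD addrA subrK.
by rewrite rpredD ?rpredZ.
Qed.

(* For G = 0: K meets (a_1^k, ..., a_r^k) F inside
   (a_1^n, ..., a_r^n) K.  In the induction the multiples of the first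
   generator are absorbed into G. *)
Lemma artin_rees (s : seq R) (K G : submodClosed F) n :
  exists k, forall x (y : nat -> F), x \in K ->
    x - \sum_(i < size s) s`_i ^+ k *: y i \in G ->
    exists2 l : nat -> F, (forall i, l i \in K) &
      x - \sum_(i < size s) s`_i ^+ n *: l i \in G.
Proof.
elim: s G => [|a s IHs] G.
  exists 0%N => x y xK; rewrite big_ord0 => xG.
  by exists (fun=> 0) => [i|]; rewrite ?rpred0 ?big_ord0.
have [k1 k1P] := artin_rees_principal a K G n.
(* The enlarged submodule is G + a^k1 F; [k1] is fixed first because the remainder below is a
   multiple of a^k1 modulo G. *)
have hG : lin_closed [set z | exists y, z - a ^+ k1 *: y \in G].
  split=> [|c x y [x' xG] [y' yG]] /=.
    by exists 0; rewrite scaler0 subr0 rpred0.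
  exists (c *: x' + y').
  rewrite scalerDr [_ *: (c *: _)]scalerA mulrC -scalerA opprD addrACA.
  by rewrite -scalerBr rpredD ?rpredZ.
have [k2 k2P] := IHs (submod_of hG).
(* Surplus powers of the generators are moved into the coefficients. *)
exists (maxn k1 k2) => x y xK; rewrite big_ord_recl /= => xG.
have := k2P x (fun i => s`_i ^+ (maxn k1 k2 - k2) *: y i.+1) xK.
case=> [|l lK /submod_ofP[z zG]].
  apply/submod_ofP; exists (a ^+ (maxn k1 k2 - k1) *: y 0%N).
  rewrite scalerA -exprD subnKC ?leq_maxl //.
  under eq_bigr do rewrite scalerA -exprD subnKC ?leq_maxr //.
  by move: xG; rewrite opprD addrA addrAC.
(* The remainder, x minus the sum over the other generators, is in K and equals a^k1 z modulo G, so
   the principal case applies. *)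
have [|l0 l0K l0G] := k1P _ z _ zG.
  by rewrite submodB // rpred_sum // => i _; rewrite rpredZ.
exists (fun i => if i is i'.+1 then l i' else l0) => [[|i]//|].
by rewrite big_ord_recl /= opprD addrA addrAC.
Qed.

End ArtinRees.

(** * Powers of a finitely generated ideal *)

Section IdealPowers.
Variables (R : comNzRingType) (I : submodClosed R^o).

Lemma mem_smul (M : lmodType R) (J : submodClosed R^o) (P : submodClosed M) a y :
  a \in J -> y \in P -> a *: y \in smul J P.
Proof. by move=> aJ yP; apply: mem_span; exists a, y. Qed.

Lemma mem_ideal_exp_mul (M : lmodType R) n a (y : M) :
  a \in ideal_exp I n -> a *: y \in ideal_exp_mul I M n.
Proof. by move=> aI; apply: mem_smul. Qed.

Lemma mem_expr_ideal_exp a n : a \in I -> a ^+ n \in ideal_exp I n.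
Proof. by move=> aI; elim: n => // n IHn; rewrite exprS; apply: mem_smul. Qed.

(** Pigeonhole: among k + m factors, either [a] occurs k times, or at least m factors come from the
    remaining elements. The other factors are absorbed because [Q] is an ideal. *)
Lemma long_products_in (s : seq R) k (Q : submodClosed R^o) :
  (forall a, a \in s -> a ^+ k \in Q) ->
  exists m, forall t : seq R, (m <= size t)%N -> {subset t <= s} ->
    \prod_(a <- t) a \in Q.
Proof.
elim: s => [|a s IHs] sQ.
  by exists 1%N => -[//|b t] _ /(_ b (mem_head _ _)).
have [|m mP] := IHs; first by move=> b bs; apply: sQ; rewrite inE bs orbT.
exists (k + m)%N => t szt ts; rewrite (bigID (pred1 a)) /=.
have [kt|tk] := leqP k (count_mem a t).
  rewrite (eq_bigr (fun=> a)) => [|b /eqP//].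
  rewrite big_const_seq iter_mulr_1 -(subnK kt) exprD mulrC mulrA.
  by apply: (@rpredZ _ _ Q); rewrite sQ ?mem_head.
apply: (@rpredZ _ _ Q); rewrite -big_filter; apply: mP => [|b].
  rewrite size_filter -(leq_add2l k) (leq_trans szt) //.
  by rewrite -(count_predC (pred1 a) t) leq_add2r ltnW.
by rewrite mem_filter => /andP[/= ba /ts]; rewrite inE (negPf ba).
Qed.

(** Induction on [m] with [Q] varying: for a in I, the claim a I^m in Q is the claim for the colon
    ideal (Q : a). A second colon ideal, by a product of generators, reduces a to a generator. *)
Lemma ideal_exp_subset (s : seq R) (Q : submodClosed R^o) m :
  I =i @span R R^o [set` s] ->
  (forall t : seq R, size t = m -> {subset t <= s} -> \prod_(a <- t) a \in Q) ->
  {subset ideal_exp I m <= Q}.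
Proof.
move=> Is; elim: m Q => [|m IHm] Q tQ x.
  move=> _; rewrite -[x]mulr1; apply: (@rpredZ _ _ Q).
  by have := tQ [::] erefl; rewrite big_nil; apply.
have colon z : lin_closed [set y : R^o | z *: y \in Q].
  split=> [|c u v /= uQ vQ]; first by rewrite /= scaler0 rpred0.
  rewrite scalerDr scalerA mulrC -scalerA.
  by apply: rpredD => //; apply: rpredZ.
move=> /spanP; apply=> _ [a [y [aI yI ->]]].
suff /submod_ofP : y \in submod_of (colon a) by [].
apply: IHm yI => t tm ts; apply/(submod_ofP (colon a)).
suff: (\prod_(b <- t) b) *: (a : R^o) \in Q by rewrite /= [_ *: _]mulrC.
rewrite Is in aI; apply: span_min (colon _) _ _ aI => b /= bs.
have := tQ (b :: t); rewrite big_cons [_ *: _]mulrC; apply=> [/=|c].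
  by rewrite tm.
by rewrite inE => /predU1P[->//|/ts].
Qed.

Lemma ideal_exp_sub_powers (s : seq R) k : I =i @span R R^o [set` s] ->
  exists m, forall x, x \in ideal_exp I m ->
    exists y : nat -> R, x = \sum_(i < size s) s`_i ^+ k * y i.
Proof.
move=> Is.
have hQ : lin_closed [set x : R^o | exists y : nat -> R,
    x = \sum_(i < size s) s`_i ^+ k * y i].
  split=> [|c _ _ [x ->] [y ->]] /=.
    by exists (fun=> 0); rewrite big1 // => i _; rewrite mulr0.
  exists (fun i => c * x i + y i); rewrite scaler_sumr -big_split /=.
  by apply: eq_bigr => i _; rewrite mulrDr mulrCA.
have [a sa|m mP] := @long_products_in s k (submod_of hQ).
  (* The coefficients are the Kronecker delta at the first position of [a] in [s]. *)
  apply/(submod_ofP hQ); exists (fun i => (i == index a s)%:R).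
  pose j := Ordinal (etrans (index_mem a s) sa).
  rewrite (bigD1 j) //= eqxx mulr1 nth_index // big1 ?addr0 // => i ij.
  by rewrite (_ : _ == _ = false) ?mulr0 //; apply/negbTE.
exists m => x xI; suff /(submod_ofP hQ) : x \in submod_of hQ by [].
by apply: (ideal_exp_subset Is) xI => t tm; apply: mP; rewrite tm.
Qed.

End IdealPowers.

(** * Direct limits of modules of homomorphisms *)

Section HomSystemLimit.
Variables (R : comNzRingType) (M N : lmodType R) (P : nat -> submodClosed M).
Hypothesis P_decr : forall i j, (i <= j)%N -> {subset P j <= P i}.

Definition hom_class n (f : {linear submodule (P n) -> N}) :
  dlim (hom_system N P_decr) := dlim_in (X := hom_system N P_decr) f.

Lemma hom_class_surj u : exists n f, u = @hom_class n f.
Proof. by have [n [f ->]] := dlim_in_surj u; exists n, f. Qed.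

Lemma hom_classP n c (f g : {linear submodule (P n) -> N}) :
  hom_class (c *: f + g : {linear submodule (P n) -> N})
  = c *: hom_class f + hom_class g.
Proof. exact: (linearP (@dlim_in R (hom_system N P_decr) n)). Qed.

Lemma hom_classZ n c (f : {linear submodule (P n) -> N}) :
  hom_class (c *: f : {linear submodule (P n) -> N}) = c *: hom_class f.
Proof. exact: (linearZ_LR (@dlim_in R (hom_system N P_decr) n)). Qed.

Lemma hom_class0 n : hom_class (0 : {linear submodule (P n) -> N}) = 0.
Proof. exact: (linear0 (@dlim_in R (hom_system N P_decr) n)). Qed.

(** Arguments are compared through their values in [M], which keeps inclusion maps out of later
    proofs. *)
Lemma hom_classE n k (f : {linear submodule (P n) -> N})
    (g : {linear submodule (P k) -> N}) :
  hom_class f = hom_class g <->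
  exists2 l, (n <= l)%N && (k <= l)%N &
    forall (x : submodule (P n)) (y : submodule (P k)),
      val x = val y -> val x \in P l -> f x = g y.
Proof.
split=> [/dlim_inP[l [nl [kl e]]]|[l /andP[nl kl] e]].
  exists l => [|x y xy xl]; first by rewrite nl.
  pose z : submodule (P l) := Submodule xl.
  have := congr1 (fun h : {linear submodule (P l) -> N} => h z) e.
  have -> : x = incl (P_decr nl) z by apply: val_inj.
  by have -> : y = incl (P_decr kl) z by apply: val_inj.
apply/dlim_inP; exists l, nl, kl; apply: linear_funP => x.
exact: (e (incl (P_decr nl) x) (incl (P_decr kl) x) erefl (valP x)).
Qed.

Lemma hom_class_eq0 n (f : {linear submodule (P n) -> N}) :
  hom_class f = 0 <->
  exists2 l, (n <= l)%N & forall x : submodule (P n), val x \in P l -> f x = 0.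
Proof.
rewrite -(hom_class0 n); split=> [/hom_classE[l]|[l nl f0]].
  by rewrite andbb => nl e; exists l => // x; apply: e.
by apply/hom_classE; exists l => [|x y _ /f0 //]; rewrite nl.
Qed.

Lemma hom_class_restrict n k (f : {linear submodule (P n) -> N}) :
  (n <= k)%N -> exists2 g : {linear submodule (P k) -> N},
    hom_class f = hom_class g &
    forall (x : submodule (P k)) (y : submodule (P n)),
      val x = val y -> g x = f y.
Proof.
move=> nk; exists (restrict (P_decr nk) f) => [|x y xy].
  apply/hom_classE; exists k => [|x y xy _]; first by rewrite nk /=.
  by congr (f _); apply: val_inj.
by congr (f _); apply: val_inj.
Qed.

End HomSystemLimit.

(** * The isomorphism between D_I(Hom(M, N)) and D_I(M, N) *)

Section HomTransform.
Variables (R : comNzRingType) (I : submodClosed R^o) (M N : lmodType R).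
Hypotheses (hR : noetherian R) (hM : fg_module M).

Definition scale_elt n (x : R^o) (xI : x \in ideal_exp I n) (m : M) :
  submodule (ideal_exp_mul I M n) :=
  @Submodule R M (ideal_exp_mul I M n) (x *: m) (mem_ideal_exp_mul m xI).

(** This is g(x m) = f(x)(m); quantifying over every [y] with value x m makes the membership proof
    irrelevant. *)
Definition adjoint n
    (f : {linear submodule (ideal_exp I n) -> {linear M -> N}})
    (g : {linear submodule (ideal_exp_mul I M n) -> N}) : Prop :=
  forall (x : submodule (ideal_exp I n)) (m : M)
    (y : submodule (ideal_exp_mul I M n)), val y = val x *: m -> g y = f x m.

Definition transform_rel (u : ideal_transform I {linear M -> N})
    (v : gen_ideal_transform I M N) : Prop :=
  exists n f g, [/\ u = @hom_class _ _ _ _ (@ideal_exp_decr R I) n f,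
    v = @hom_class _ _ _ _ (@ideal_exp_mul_decr R I M) n g & adjoint f g].

Lemma adjoint_restrict n k f g : (n <= k)%N -> @adjoint n f g ->
  exists f' g', [/\ hom_class (@ideal_exp_decr R I) f
                    = hom_class (@ideal_exp_decr R I) f',
    hom_class (@ideal_exp_mul_decr R I M) g
    = hom_class (@ideal_exp_mul_decr R I M) g' & @adjoint k f' g'].
Proof.
move=> nk fg.
have [f' ff' f'P] := hom_class_restrict (@ideal_exp_decr R I) f nk.
have [g' gg' g'P] := hom_class_restrict (@ideal_exp_mul_decr R I M) g nk.
exists f', g'; split=> // x m y xy.
pose x' : submodule (ideal_exp I n) := Submodule (ideal_exp_decr nk (valP x)).
pose y' : submodule (ideal_exp_mul I M n) :=
  Submodule (ideal_exp_mul_decr nk (valP y)).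
by rewrite (g'P y y') // (f'P x x') // (fg x' m).
Qed.

Lemma transform_relD c u u' v v' : transform_rel u v -> transform_rel u' v' ->
  transform_rel (c *: u + u') (c *: v + v').
Proof.
move=> [n [f [g [-> -> fg]]]] [k [f' [g' [-> -> fg']]]].
have [f1 [g1 [-> -> fg1]]] := adjoint_restrict (leq_maxl n k) fg.
have [f2 [g2 [-> -> fg2]]] := adjoint_restrict (leq_maxr n k) fg'.
exists (maxn n k), (c *: f1 + f2), (c *: g1 + g2).
split; rewrite ?hom_classP // => x m y xy /=.
by rewrite (fg1 x m y) ?(fg2 x m y).
Qed.

(** The points where [g] and [h] agree form a submodule containing the generators x m of I^n M. *)
Lemma gen_hom_ext n (g h : {linear submodule (ideal_exp_mul I M n) -> N}) :
  (forall x m (y : submodule (ideal_exp_mul I M n)), x \in ideal_exp I n ->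
    val y = x *: m -> g y = h y) ->
  g = h.
Proof.
move=> gh; apply: linear_funP => y.
have hA : lin_closed [set z | exists2 y : submodule (ideal_exp_mul I M n),
    val y = z & g y = h y].
  split=> [|c _ _ [x <- xP] [z <- zP]] /=; first by exists 0; rewrite ?linear0.
  by exists (c *: x + z); rewrite // !linearP xP zP.
have [|z /val_inj-> //] := span_min hA _ (valP y).
move=> _ [x [m [xI _ ->]]]; exists (scale_elt xI m) => //.
exact: (gh x m).
Qed.

Lemma transform_rel_injl v : transform_rel 0 v -> v = 0.
Proof.
move=> [n [f [g [/esym/hom_class_eq0[k nk f0] -> fg]]]].
apply/hom_class_eq0.
have [g' gg' g'P] := hom_class_restrict (@ideal_exp_mul_decr R I M) g nk.
exists k => // y yk; pose y' := Submodule yk.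
rewrite -(g'P y') // (_ : g' = 0) //; apply: gen_hom_ext => x m z xk zE.
pose x' : submodule (ideal_exp I n) := Submodule (ideal_exp_decr nk xk).
pose z' : submodule (ideal_exp_mul I M n) :=
  Submodule (ideal_exp_mul_decr nk (valP z)).
by rewrite (g'P z z') // (fg x' m) // f0.
Qed.

Lemma transform_rel_injr u : transform_rel u 0 -> u = 0.
Proof.
move=> [n [f [g [-> /esym/hom_class_eq0[k nk g0] fg]]]].
apply/hom_class_eq0; exists k => // x xk; apply: linear_funP => m.
have xmk := mem_ideal_exp_mul m xk.
by rewrite -(fg x m (scale_elt (valP x) m)) ?g0.
Qed.

(** A given [g] is adjoint to the map taking x to m |-> g(x m). *)
Lemma transform_rel_surj v : exists u, transform_rel u v.
Proof.
have [n [g ->]] := hom_class_surj v.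
have /choice[f fP] : forall x : submodule (ideal_exp I n),
    exists h : {linear M -> N}, forall m (y : submodule (ideal_exp_mul I M n)),
      val y = val x *: m -> g y = h m.
  move=> x.
  pose F m := g (scale_elt (valP x) m).
  have [|h hF] := @linear_bundle _ _ _ F.
    move=> c m m'; rewrite /F -linearP; congr (g _); apply: val_inj => /=.
    by rewrite scalerDr !scalerA mulrC.
  by exists h => m y yE; rewrite hF; congr (g _); apply: val_inj.
have [|f' f'E] := @linear_bundle _ _ _ f.
  move=> c x x'; apply: linear_funP => m /=.
  pose y (z : submodule (ideal_exp I n)) := scale_elt (valP z) m.
  rewrite -(fP _ m (y (c *: x + x'))) // -(fP x m (y x)) // -(fP x' m (y x')) //.
  rewrite -linearP; congr (g _); apply: val_inj => /=.
  by rewrite scalerDl scalerA.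
exists (hom_class (@ideal_exp_decr R I) f'), n, f', g; split=> // x m y yE.
by rewrite f'E; apply: fP.
Qed.

Lemma row_comb_closed p (m : 'I_p -> M) :
  lin_closed [set x : 'rV[R]_p | \sum_j x 0 j *: m j = 0].
Proof.
split=> [|c x y /= x0 y0] /=.
  by rewrite big1 // => j _; rewrite mxE scale0r.
transitivity (c *: (\sum_j x 0 j *: m j) + \sum_j y 0 j *: m j).
  rewrite scaler_sumr -big_split /=; apply: eq_bigr => j _.
  by rewrite !mxE scalerDl scalerA.
by rewrite x0 y0 scaler0 addr0.
Qed.

Lemma sum_linearE (U V : lmodType R) (T : finType) (h : T -> {linear U -> V}) x :
  (\sum_i h i) x = \sum_i h i x.
Proof. by apply: (big_morph (fun f : {linear U -> V} => f x)). Qed.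

(* A relation with coefficients in I^l is sum_i a_i^n L_i for relations L_i,
   and f (a_i^n) kills each L_i. *)
Lemma hom_relation_vanish p (m : 'I_p -> M) n
    (f : {linear submodule (ideal_exp I n) -> {linear M -> N}}) :
  exists l, forall x : 'I_p -> submodule (ideal_exp I n),
    (forall j, val (x j) \in ideal_exp I l) ->
    \sum_j val (x j) *: m j = 0 -> \sum_j f (x j) (m j) = 0.
Proof.
have [s sI] := hR I.
have hG : lin_closed [set x : 'rV[R]_p | x = 0].
  by split=> [|c x y -> ->] //=; rewrite scaler0 addr0.
have aF := acc_row (p := p) (acc_noetherian hR).
(* Here K is the module of relations between the m_j, and G = 0. *)
have [k kP] := artin_rees aF s (submod_of (row_comb_closed m)) (submod_of hG) n.
have [l lP] := ideal_exp_sub_powers k sI.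
exists l => x xl x0.
have /choice[y yP] j := lP _ (xl j).
have [||L LK /submod_ofP /eqP] :=
  kP (\row_j (val (x j) : R)) (fun i => \row_j y j i).
- apply/submod_ofP => /=; rewrite -[RHS]x0; apply: eq_bigr => j _.
  by rewrite mxE.
- apply/submod_ofP; apply/rowP => j; rewrite !mxE yP summxE.
  by rewrite -sumrB big1 // => i _; rewrite !mxE subrr.
rewrite subr_eq0 => /eqP/rowP xE.
have sIn (i : 'I_(size s)) : s`_i ^+ n \in ideal_exp I n.
  by apply: mem_expr_ideal_exp; rewrite sI; apply/mem_span/mem_nth.
pose e i : submodule (ideal_exp I n) := Submodule (sIn i).
have xjE j : x j = \sum_(i < size s) L i 0 j *: e i.
  apply: val_inj; rewrite raddf_sum; have := xE j; rewrite mxE => ->.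
  by rewrite summxE; apply: eq_bigr => i _; rewrite mxE /= mulrC.
(* Linearity moves the coefficients L_ij onto the m_j; after exchanging the sums, f(e_i) is applied
   to the sum over j of L_ij m_j, which is 0. *)
transitivity (\sum_j \sum_(i < size s) f (e i) (L i 0 j *: m j)).
  apply: eq_bigr => j _; rewrite xjE linear_sum sum_linearE.
  by apply: eq_bigr => i _; rewrite !linearZ.
rewrite exchange_big big1 // => i _; rewrite -linear_sum.
by have /submod_ofP /= -> := LK i; rewrite linear0.
Qed.

Lemma transform_rel_total u : exists v, transform_rel u v.
Proof.
have [n [f ->]] := hom_class_surj u.
have [p [m mP]] := fg_generators hM.
have [l lP] := hom_relation_vanish m f.
(* k >= n allows restricting [f] to I^k; k >= l puts the coefficients in I^l, where relations are
   killed. *)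
set k := maxn n l; have nk : (n <= k)%N := leq_maxl n l.
have [f' ff' f'P] := hom_class_restrict (@ideal_exp_decr R I) f nk.
pose rel (y : submodule (ideal_exp_mul I M k)) (w : N) :=
  exists2 x : 'I_p -> submodule (ideal_exp I k),
    val y = \sum_j val (x j) *: m j & w = \sum_j f' (x j) (m j).
have relD c y y' w w' : rel y w -> rel y' w' -> rel (c *: y + y') (c *: w + w').
  move=> [x yE ->] [x' y'E ->]; exists (fun j => c *: x j + x' j) => /=.
    rewrite yE y'E scaler_sumr -big_split /=; apply: eq_bigr => j _.
    by rewrite scalerDl scalerA.
  rewrite scaler_sumr -big_split /=; apply: eq_bigr => j _.
  by rewrite linearP.
have [y|w|g gP] := linear_of_relation relD.
- have hA : @lin_closed R M [set z | exists x : 'I_p -> submodule (ideal_exp I k),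
      z = \sum_j val (x j) *: m j].
    split=> [|c _ _ [x ->] [x' ->]] /=.
      by exists (fun=> 0); rewrite big1 // => j _; rewrite scale0r.
    exists (fun j => c *: x j + x' j); rewrite scaler_sumr -big_split /=.
    by apply: eq_bigr => j _; rewrite scalerDl scalerA.
  have [|x xP] := span_min hA _ (valP y); last first.
    by exists (\sum_j f' (x j) (m j)); exists x.
  move=> _ [b [z [bI _ ->]]]; have [r ->] := mP z.
  pose b' : submodule (ideal_exp I k) := Submodule bI.
  exists (fun j => r 0 j *: b'); rewrite scaler_sumr; apply: eq_bigr => j _.
  by rewrite scalerA mulrC.
- move=> [x /esym x0 ->].
  pose x' j : submodule (ideal_exp I n) :=
    Submodule (ideal_exp_decr nk (valP (x j))).
  rewrite -[RHS](lP x') //; first by apply: eq_bigr => j _; rewrite (f'P _ (x' j)).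
  by move=> j; apply: ideal_exp_decr (leq_maxr n l) _ (valP (x j)).
exists (hom_class (@ideal_exp_mul_decr R I M) g), k, f', g; split=> //.
(* If m0 is the sum of the r_j m_j, then x m0 has coefficients r_j x in I^k. *)
move=> x m0 y yE; apply: gP; have [r rE] := mP m0.
exists (fun j => r 0 j *: x); rewrite ?yE rE ?scaler_sumr ?linear_sum.
  by apply: eq_bigr => j _; rewrite scalerA mulrC.
by apply: eq_bigr => j _; rewrite !linearZ.
Qed.

Lemma ideal_transform_hom_iso :
  module_iso (ideal_transform I {linear M -> N}) (gen_ideal_transform I M N).
Proof.
exact: (module_iso_of_relation transform_relD
  transform_rel_total transform_rel_surj transform_rel_injl transform_rel_injr).
Qed.

End HomTransform.

(** * Principal ideals and localization *)

Section Principal.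
Variables (R : comNzRingType) (a : R).

(** If [a] acts bijectively, so do its powers, hence every fraction can be written with denominator
    1 in exactly one way. *)
Lemma localize_at_iso (L : lmodType R) :
  (forall u : L, a *: u = 0 -> u = 0) ->
  (forall u : L, exists v : L, a *: v = u) -> module_iso L (localize_at a L).
Proof.
move=> inj surj.
have injX i (u : L) : a ^+ i *: u = 0 -> u = 0.
  elim: i => [|i IHi]; first by rewrite scale1r.
  by rewrite exprS -scalerA => /inj/IHi.
have surjX i (u : L) : exists v : L, a ^+ i *: v = u.
  elim: i u => [|i IHi] u; first by exists u; rewrite scale1r.
  have [v <-] := surj u; have [w <-] := IHi v.
  by exists w; rewrite exprS -scalerA.
pose one := denom1 (powers a).
apply: (module_iso_of_relation
  (rel := fun u (v : localize_at a L) => v = frac u one)) => //.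
- by move=> c u u' _ _ -> ->; rewrite fracZ fracDl.
- by move=> u; exists (frac u one).
- move=> v; have [x [s ->]] := frac_surj v.
  have /asboolP[i si] := denP s.
  have [y yx] := surjX i x; exists y; apply/fracP; exists one.
  by rewrite /= mulr1 scale1r mul1r si.
move=> u /fracP[t]; rewrite scaler0 /= mulr1 => /esym.
by have /asboolP[i ->] := denP t; move=> /injX.
Qed.

Variables (I : submodClosed R^o) (M N : lmodType R).
Hypothesis aI : forall x : R, x \in I <-> exists r : R, x = a * r.

Lemma mem_principal_exp_mul n (y : M) :
  y \in ideal_exp_mul I M n <-> exists z, y = a ^+ n *: z.
Proof.
split=> [|[z ->]]; last first.
  apply/mem_ideal_exp_mul/mem_expr_ideal_exp/aI.
  by exists 1; rewrite mulr1.
have expE : forall x, x \in ideal_exp I n -> exists r : R, x = a ^+ n * r.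
  elim: n => [|n IHn] x; first by exists x; rewrite mul1r.
  have hA : lin_closed [set x : R^o | exists r : R, x = a ^+ n.+1 * r].
    split=> [|c _ _ [r ->] [r' ->]] /=; first by exists 0; rewrite mulr0.
    by exists (c * r + r'); rewrite mulrDr mulrCA.
  apply: (span_min hA) => _ [b [t [/aI[r ->] /IHn[r' ->] ->]]].
  by exists (r * r'); rewrite exprS [_ *: _]mulrACA.
apply: (span_min (B := [set y : M | exists z, y = a ^+ n *: z])).
  split=> [|c _ _ [x ->] [z ->]] /=; first by exists 0; rewrite scaler0.
  by exists (c *: x + z); rewrite scalerDr !scalerA mulrC.
by move=> _ [x [z [/expE[r ->] _ ->]]]; exists (r *: z); rewrite scalerA.
Qed.

Lemma principal_transform_inj (u : gen_ideal_transform I M N) :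
  a *: u = 0 -> u = 0.
Proof.
have [n [f ->]] := hom_class_surj u.
rewrite -hom_classZ => /hom_class_eq0[k nk f0].
(* If a f vanishes on a^k M, then f vanishes on a (a^k M), hence the shift by one. *)
apply/hom_class_eq0; exists k.+1 => [|x]; first exact: leqW.
move=> /mem_principal_exp_mul[z xE].
have zk : a ^+ k *: z \in ideal_exp_mul I M k.
  by apply/mem_principal_exp_mul; exists z.
pose y : submodule (ideal_exp_mul I M n) :=
  @Submodule R M (ideal_exp_mul I M n) _ (ideal_exp_mul_decr nk zk).
have -> : x = a *: y by apply: val_inj; rewrite xE exprS -scalerA.
by rewrite linearZ -[RHS](f0 y zk).
Qed.

Lemma principal_transform_surj : acc M ->
  forall u : gen_ideal_transform I M N, exists v, a *: v = u.
Proof.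
move=> aM u; have [n [f ->]] := hom_class_surj u.
have [c cP] := acc_ker_stable a aM.
(* k >= n makes [f] defined on a^k M; k >= c gives that a^(k+1) z = 0 implies a^k z = 0, so that
   division by a is well defined. *)
set k := maxn n c; have nk : (n <= k)%N := leq_maxl n c.
pose rel (y : submodule (ideal_exp_mul I M k.+1)) (w : N) :=
  exists x : submodule (ideal_exp_mul I M n),
    [/\ val x \in ideal_exp_mul I M k, val y = a *: val x & w = f x].
have relD b y y' w w' : rel y w -> rel y' w' -> rel (b *: y + y') (b *: w + w').
  move=> [x [xk yE ->]] [x' [xk' yE' ->]]; exists (b *: x + x').
  split; last by rewrite linearP.
    by apply: rpredD => //; apply: rpredZ.
  by rewrite /= yE yE' scalerDr !scalerA mulrC.
have [y|w|g gP] := linear_of_relation relD.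
- have /mem_principal_exp_mul[z yE] := valP y.
  have zk : a ^+ k *: z \in ideal_exp_mul I M k.
    by apply/mem_principal_exp_mul; exists z.
  pose x : submodule (ideal_exp_mul I M n) :=
    @Submodule R M (ideal_exp_mul I M n) _ (ideal_exp_mul_decr nk zk).
  by exists (f x), x; split=> //; rewrite yE exprS -scalerA.
- move=> [x [/mem_principal_exp_mul[z xE] /esym]] /=.
  rewrite xE scalerA -exprS => /(cP k z (leq_maxr n c)) z0 ->.
  by rewrite (_ : x = 0) ?linear0 //; apply: val_inj; rewrite xE z0.
exists (hom_class (@ideal_exp_mul_decr R I M) g).
rewrite -hom_classZ.
(* On y = a x' in a^(k+1) M, a g(y) = a f(x') = f(a x') = f(y). *)
apply/hom_classE; exists k.+1 => [|y x yx _].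
  by rewrite leqnn ltnW.
have /mem_principal_exp_mul[z yE] := valP y.
have zk : a ^+ k *: z \in ideal_exp_mul I M k.
  by apply/mem_principal_exp_mul; exists z.
pose x' : submodule (ideal_exp_mul I M n) :=
  @Submodule R M (ideal_exp_mul I M n) _ (ideal_exp_mul_decr nk zk).
have yx' : val y = a *: val x' by rewrite yE exprS -scalerA.
rewrite /= (gP y (f x')); last by exists x'.
by rewrite -linearZ; congr (f _); apply: val_inj; rewrite -yx.
Qed.

End Principal.

Theorem theorem2p7 (R : comNzRingType) (hR : noetherian R)
    (I : submodClosed R^o) (M N : lmodType R) (hM : fg_module M) :
  module_iso (ideal_transform I {linear M -> N}) (gen_ideal_transform I M N) /\
  (forall a : R, (forall x : R, x \in I <-> exists r : R, x = a * r) ->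
     module_iso (gen_ideal_transform I M N)
                (localize_at a (gen_ideal_transform I M N))).
Proof.
split=> [|a aI]; first exact: ideal_transform_hom_iso.
apply: localize_at_iso; first exact: principal_transform_inj aI.
exact: (principal_transform_surj aI (acc_fg hR hM)).
Qed.
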